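(* There is an absolute constant $C\ge1$ such that the following holds. Let $G$ be a finite group with a finite symmetric generating set $S$, and let $c_G=\max\big(2,\max_{R>0}|B(2R)|/|B(R)|\big)$, where $B(R)$ is the closed ball of radius $R$ about the identity in the word metric of $\mathrm{Cay}(G;S)$. Then there exists a finite-dimensional real vector space $W$ and a representation $\rho_W:G\to GL(W)$ such that (1) $\dim W\le \exp\big(C(\log c_G)^2\big)$, and (2) $|\rho_W(G)|\ge \dfrac{|G|^{1/\log_2 c_G}}{C\,c_G^{\,C}}$. Moreover, one may take $W$ to be the eigenspace of the second eigenvalue $\lambda_2$ of the Laplacian on $\mathrm{Cay}(G;S)$, with $G$ acting by $(\rho(g)f)(x)=f(g^{-1}x)$.
   Context: The Cayley graph $\mathrm{Cay}(G;S)$ has vertex set $G$, with $x$ adjacent to $xs$ for each $s\in S$; it is $d$-regular with $d=|S|$, and its shortest-path metric is the word metric. Its Laplacian acts on $f:G\to\mathbb R$ by $(\Delta f)(x)=f(x)-\frac1d\sum_{s\in S}f(xs)$; its eigenvalues listed with multiplicity are $0=\lambda_1<\lambda_2\le\cdots\le\lambda_{|G|}$, and the second eigenspace is $\{f:\Delta f=\lambda_2 f\}$. *)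

(* Defs.v *)
From Stdlib Require Import Reals ClassicalEpsilon.
From mathcomp Require Import all_boot all_fingroup.
Delimit Scope R_scope with Re.
Set Implicit Arguments. Unset Strict Implicit. Unset Printing Implicit Defensive.

Definition pb (P : Prop) : bool :=
  if excluded_middle_informative P then true else false.

Section Cayley.
Variables (gT : finGroupType) (S : {set gT}).

Definition ball (r : R) : {set gT} :=
  [set g | pb (exists w : seq gT,
                 all (fun s => s \in S) w /\ (INR (size w) <= r)%Re /\
                 \prod_(s <- w) s = g)%g].

Definition laplacian (f : gT -> R) (x : gT) : R :=
  (f x - / INR #|S| * \big[Rplus/0%Re]_(s in S) f (x * s)%g)%Re.

Definition eigvec (mu : R) (f : gT -> R) : Prop :=
  forall x, laplacian f x = (mu * f x)%Re.

Definition lin_indep (k : nat) (F : 'I_k -> gT -> R) : Prop :=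
  forall a : 'I_k -> R,
    (forall x, \big[Rplus/0%Re]_(i < k) (a i * F i x)%Re = 0%Re) -> forall i, a i = 0%Re.

(* dimension of a linear subspace W of R^G : maximal size of a linearly
   independent family in W (any such family has size <= |G|) *)
Definition dimsub (W : (gT -> R) -> Prop) : nat :=
  \max_(k < #|gT|.+1 | pb (exists F : 'I_k -> gT -> R,
                              lin_indep F /\ forall i, W (F i))) k.

(* number of eigenvalues <= mu, counted with multiplicity
   (= dimension of the span of all eigenvectors with eigenvalue <= mu) *)
Definition count_eig_le (mu : R) : nat :=
  \max_(k < #|gT|.+1 | pb (exists F : 'I_k -> gT -> R,
          lin_indep F /\ forall i, exists nu, (nu <= mu)%Re /\ eigvec nu (F i))) k.

(* mu is lambda_2, the second eigenvalue in the nondecreasing list of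
   eigenvalues with multiplicity: lambda_j = min { mu | count_eig_le mu >= j } *)
Definition is_lambda2 (mu : R) : Prop :=
  (2 <= count_eig_le mu)%N /\ forall nu, (nu < mu)%Re -> (count_eig_le nu < 2)%N.

Definition eigspace2 (mu : R) (f : gT -> R) : Prop := eigvec mu f.

(* rho(g) f = (x |-> f (g^-1 x)); two group elements have the same image in
   GL(W) iff they act identically on every f in W *)
Definition same_action (W : (gT -> R) -> Prop) (g h : gT) : bool :=
  pb (forall f, W f -> forall x, f (g^-1 * x)%g = f (h^-1 * x)%g).

Definition image_card (W : (gT -> R) -> Prop) : nat :=
  #|[set [set h | same_action W g h] | g : gT]|.

Definition is_max_doubling (m : R) : Prop :=
  (exists R0, (0 < R0)%Re /\ m = (INR #|ball (2 * R0)| / INR #|ball R0|)%Re) /\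
  (forall R0, (0 < R0)%Re -> (INR #|ball (2 * R0)| / INR #|ball R0| <= m)%Re).

End Cayley.

(* Main.v *)
(* Let D be the diameter, c the doubling constant and d = |S| <= c.

   The difference of two disjoint translates of the bump max(0, r - |x|), r about
   D / 2, has mean zero and small Rayleigh quotient, whence lambda_2 <= 16 c / D^2.

   Dimension. Cover G by balls of radius r = D / 2^k. If an eigenfunction f has
   average zero on each ball, the Poincare inequality on balls together with
   bounded overlap gives |f|^2 <= 4 c^5 r^2 lambda_2 |f|^2, so f = 0 as soon as
   2^k > 8 c^3. Hence dim W is at most the number of balls, which is at most
   c^(k + 1).

   Image. With n = |rho(G)|, every element of G acts on W like a word of length at
   most n, so the global Poincare inequality holds for eigenfunctions with n in
   place of D: 1 <= n^2 d lambda_2. Hence n >= D / (4 c), whereas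
   |G| <= c^k for the least k with D < 2^k <= 2 D. *)
Require Import Defs.
From Stdlib Require Import Reals ClassicalEpsilon Lra.
From mathcomp Require Import boolp classical_sets reals topology normedtype derive Rstruct.
From mathcomp Require Import all_boot all_order all_fingroup all_algebra.
From mathcomp Require Import ring lra zify.
Set Implicit Arguments. Unset Strict Implicit. Unset Printing Implicit Defensive.

(** * Rayleigh quotients of symmetric matrices *)

Section Spectral.
Import Order.TTheory GRing.Theory Num.Theory numFieldNormedType.Exports.
Local Open Scope ring_scope.

Definition dotr (R : pzRingType) n (u v : 'rV[R]_n) : R := \sum_i u 0 i * v 0 i.

Lemma dotrC (R : comPzRingType) n (u v : 'rV[R]_n) : dotr u v = dotr v u.
Proof. by apply: eq_bigr => i _; rewrite mulrC. Qed.

Lemma dotrDl (R : comPzRingType) n a (u v w : 'rV[R]_n) :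
  dotr (u + a *: v) w = dotr u w + a * dotr v w.
Proof.
by rewrite mulr_sumr -big_split; apply: eq_bigr => i _; rewrite !mxE mulrDl mulrA.
Qed.

Lemma dotrDr (R : comPzRingType) n a (u v w : 'rV[R]_n) :
  dotr w (u + a *: v) = dotr w u + a * dotr w v.
Proof. by rewrite dotrC dotrDl !(dotrC _ w). Qed.

Lemma dotr0l (R : pzRingType) n (u : 'rV[R]_n) : dotr 0 u = 0.
Proof. by apply: big1 => i _; rewrite mxE mul0r. Qed.

Lemma dotrZl (R : comPzRingType) n a (u v : 'rV[R]_n) : dotr (a *: u) v = a * dotr u v.
Proof. by rewrite -[a *: u]add0r dotrDl dotr0l add0r. Qed.

Lemma dotr_mulmx (R : comPzRingType) n (A : 'M[R]_n) (u v : 'rV[R]_n) :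
  A^T = A -> dotr (u *m A) v = dotr u (v *m A).
Proof.
move=> sA; rewrite /dotr.
under eq_bigr do rewrite mxE mulr_suml.
rewrite exchange_big; apply: eq_bigr => i _ /=.
rewrite mxE mulr_sumr; apply: eq_bigr => j _.
have -> : A i j = A j i by rewrite -[in LHS]sA mxE.
ring.
Qed.

Lemma dotr_ge0 (R : realDomainType) n (u : 'rV[R]_n) : 0 <= dotr u u.
Proof. by apply: sumr_ge0 => i _; rewrite -expr2 sqr_ge0. Qed.

Lemma dotr_eq0 (R : realDomainType) n (u : 'rV[R]_n) : dotr u u = 0 -> u = 0.
Proof.
move=> /eqP; rewrite psumr_eq0 => [/allP u0|i _]; last by rewrite -expr2 sqr_ge0.
apply/rowP => i; rewrite mxE.
by have := u0 i (mem_index_enum i); rewrite mulf_eq0 orbb => /eqP.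
Qed.

Lemma continuous_dotr (R : realType) n (A : 'M[R]_n.+1) (w : 'rV[R]_n.+1) :
  continuous (fun u : 'rV[R]_n.+1 => dotr (u *m A) u) /\
  continuous (fun u : 'rV[R]_n.+1 => dotr u w).
Proof.
have cs (F : 'I_n.+1 -> 'rV[R]_n.+1 -> R) :
    (forall i, continuous (F i)) -> continuous (fun u => \sum_i F i u).
  by move=> cF; apply: (continuous_big (op := +%R)) => // x; exact: add_continuous.
have cc i : continuous (fun u : 'rV[R]_n.+1 => u 0 i) by exact: coord_continuous.
split; last by apply: (cs) => i u; apply: (continuousM (cc i u)); exact: cst_continuous.
apply: (cs) => i u; apply: continuousM (cc i u).
have -> : (fun u : 'rV[R]_n.+1 => (u *m A) 0 i) = (fun u => \sum_j u 0 j * A j i).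
  by apply/funext => v; rewrite mxE.
by apply: (cs) => j v; apply: (continuousM (cc j v)); exact: cst_continuous.
Qed.

(* The minimiser u of the Rayleigh quotient on the unit sphere of w^perp is an
   eigenvector: test minimality along u + t v with v = uA - mu u. *)
Lemma rayleigh_eigenvector (R : realType) n (A : 'M[R]_n.+1) (w f : 'rV[R]_n.+1) :
  A^T = A -> w *m A = 0 -> f != 0 -> dotr f w = 0 ->
  exists u mu, [/\ u != 0, dotr u w = 0, u *m A = mu *: u
                 & mu * dotr f f <= dotr (f *m A) f].
Proof.
move=> sA wA f0 fw.
have [cq cw] := continuous_dotr A w.
(* With the identity matrix the quadratic form is the squared norm, so the unit sphere in [K] is
   closed by the same continuity lemma. *)
have [c1 _] := continuous_dotr 1%:M w.
pose K := [set u : 'rV[R]_n.+1 | dotr (u *m 1%:M) u = 1 /\ dotr u w = 0]%classic.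
have ff : 0 < dotr f f.
  by rewrite lt_def dotr_ge0 andbT; apply: contra f0 => /eqP/dotr_eq0 ->.
have nrm (v : 'rV[R]_n.+1) : 0 < dotr v v -> dotr v w = 0 -> K ((Num.sqrt (dotr v v))^-1 *: v).
  move=> v0 vw; rewrite /K /= mulmx1.
  have h := sqr_sqrtr (ltW v0).
  set s := Num.sqrt _ in h *.
  have s0 : s != 0 by apply: contraTneq v0 => s0; rewrite -h s0 expr0n ltxx.
  rewrite !dotrZl dotrC dotrZl vw mulr0 -h; split=> //.
  by field.
have K0 : (K !=set0)%classic by eexists; exact: nrm ff fw.
have clK : topology_structure.closed K.
  have -> : K = ((fun u : 'rV[R]_n.+1 => dotr (u *m 1%:M) u) @^-1` [set 1] `&` (fun u : 'rV[R]_n.+1 => dotr u w) @^-1` [set 0])%classic by [].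
  by apply: closedI; apply: preimage_closed (@closed_eq _ _) => u _; [exact: c1 | exact: cw].
have bK : bounded_set K.
  exists 1; split=> // M M1 u [u1 _].
  rewrite mulmx1 in u1.
  rewrite /= /Num.norm /= mx_normrE; apply: bigmax_le => [|[i j] _ /=]; first by rewrite (le_trans ler01) // ltW.
  rewrite (ord1 i) (le_trans _ (ltW M1)) //.
  have : u 0 j ^+ 2 <= 1.
    rewrite -u1 /dotr (bigD1 j) //= expr2 lerDl.
    by apply: sumr_ge0 => k _; rewrite -expr2 sqr_ge0.
  by rewrite -real_normK ?num_real // expr_le1.
have [u [u1 uw] umin] : exists2 u, K u & forall v, K v -> dotr (u *m A) u <= dotr (v *m A) v.
  have [u Ku h] := EVT_min_rV K0 (bounded_closed_compact bK clK) (continuous_subspaceT cq).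
  by exists u; [exact: set_mem | move=> v Kv; apply: h; exact: mem_set].
rewrite mulmx1 in u1.
set mu := dotr (u *m A) u in umin.
(* By homogeneity minimality on the sphere extends to all of the orthogonal complement of [w]; the
   zero vector cannot be normalised and is treated apart. *)
have pmin v : dotr v w = 0 -> mu * dotr v v <= dotr (v *m A) v.
  move=> vw; have := dotr_ge0 v; rewrite le_eqVlt => /orP[/eqP/esym v0|v0].
    by rewrite (dotr_eq0 v0) mul0mx dotr0l mulr0.
  have := umin _ (nrm v v0 vw).
  have h := sqr_sqrtr (ltW v0).
  set s := Num.sqrt _ in h *.
  have s0 : s != 0 by apply: contraTneq v0 => s0; rewrite -h s0 expr0n ltxx.
  have -> : dotr ((s^-1 *: v) *m A) (s^-1 *: v) = dotr (v *m A) v / dotr v v.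
    by rewrite -h -scalemxAl dotrZl dotrC dotrZl dotrC; field.
  by rewrite ler_pdivlMr.
exists u, mu; split=> //; last exact: pmin.
  apply: contraPneq u1 => ->; apply/eqP.
  by rewrite dotr0l eq_sym oner_eq0.
pose v : 'rV[R]_n.+1 := u *m A + (- mu) *: u.
suff /dotr_eq0 /eqP : dotr v v = 0 by rewrite /v scaleNr subr_eq0 => /eqP.
have vw : dotr v w = 0.
  by rewrite dotrDl uw dotr_mulmx // wA dotrC dotr0l mulr0 addr0.
have vv : dotr v v = dotr (u *m A) v - mu * dotr u v by rewrite {1}/v dotrDl mulNr.
clearbody v.
have key t : 0 <= 2 * t * dotr v v + t ^+ 2 * (dotr (v *m A) v - mu * dotr v v).
  have := pmin (u + t *: v); rewrite dotrDl uw vw mulr0 addr0 => /(_ erefl).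
  rewrite mulmxDl -scalemxAl !dotrDl !dotrDr (dotrC v u) -/mu u1 (dotr_mulmx v u) //.
  rewrite (dotrC v (u *m A)).
  rewrite -subr_ge0 => h; apply: le_trans h _; rewrite le_eqVlt; apply/orP; left; apply/eqP.
  rewrite vv; move: (dotr (u *m A) v) (dotr u v) (dotr (v *m A) v) => a b q; ring.
have := pmin v vw; rewrite -subr_ge0.
have := dotr_ge0 v.
move: (dotr v v) (dotr (v *m A) v - _) key => a b key a0 b0.
apply/eqP; rewrite eq_le a0 andbT.
(* A small negative [t] makes the linear term of [key] dominate. This choice gives
   [- a ^+ 2 * (b + 2) / (b + 1) ^+ 2], and [b + 1] avoids dividing by zero. *)
have := key (- a / (b + 1)).
have b1 : 0 < b + 1 by lra.
have -> : 2 * (- a / (b + 1)) * a + (- a / (b + 1)) ^+ 2 * b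
   = - (a ^+ 2 * (b + 2) / (b + 1) ^+ 2) by field; rewrite lt0r_neq0.
rewrite oppr_ge0 ler_pdivrMr ?exprn_gt0 // mul0r => h.
rewrite leNgt; apply/negP => apos.
have : 0 < a ^+ 2 * (b + 2) by rewrite mulr_gt0 ?exprn_gt0 //; lra.
by rewrite ltNge h.
Qed.

(** The matrix statement carried over to functions by enumerating [T]. Here [w] is the constant
    vector: zero row sums say that it lies in the kernel, and orthogonality to it is mean zero. *)
Lemma rayleigh_function (R : realType) (T : finType) (a : T -> T -> R) (f : T -> R) :
  (forall x y, a x y = a y x) -> (forall x, \sum_y a x y = 0) ->
  (exists x, f x != 0) -> \sum_x f x = 0 ->
  exists u mu, [/\ exists x, u x != 0, \sum_x u x = 0,
    forall x, \sum_y a x y * u y = mu * u x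
    & mu * \sum_x f x ^+ 2 <= \sum_x (\sum_y a x y * f y) * f x].
Proof.
move=> sa a0 [t0 ft0] f0.
have [n En] : exists n, #|T| = n.+1.
  by exists #|T|.-1; rewrite prednK //; apply/card_gt0P; exists t0.
pose e (i : 'I_n.+1) : T := enum_val (cast_ord (esym En) i).
pose e' (x : T) : 'I_n.+1 := cast_ord En (enum_rank x).
have ee' : cancel e' e by move=> x; rewrite /e /e' cast_ordK enum_rankK.
have e'e : cancel e e' by move=> x; rewrite /e /e' enum_valK cast_ordKV.
have sumE (h : T -> R) : \sum_x h x = \sum_i h (e i).
  by rewrite (reindex e) //; exists e' => x _; [exact: e'e | exact: ee'].
pose A := \matrix_(i, j) a (e i) (e j).
pose w : 'rV[R]_n.+1 := const_mx 1.
pose F : 'rV[R]_n.+1 := \row_i f (e i).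
have dw v : dotr v w = \sum_i v 0 i by apply: eq_bigr => i _; rewrite mxE mulr1.
have [||||u [mu [u0 uw uA hu]]] := @rayleigh_eigenvector R n A w F.
- by apply/matrixP => i j; rewrite !mxE sa.
- apply/rowP => j; rewrite !mxE -[RHS](a0 (e j)) sumE.
  by apply: eq_bigr => i _; rewrite !mxE mul1r sa.
- apply: contraNneq ft0 => /rowP/(_ (e' t0)); rewrite !mxE ee' => ->; exact: eqxx.
- by rewrite dw -[RHS]f0 sumE; apply: eq_bigr => i _; rewrite mxE.
have AE (v : 'rV[R]_n.+1) x : \sum_y a x y * v 0 (e' y) = (v *m A) 0 (e' x).
  rewrite mxE sumE; apply: eq_bigr => i _.
  by rewrite mxE e'e ee' mulrC sa.
exists (fun x => u 0 (e' x)), mu; split.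
- have [i ui] : exists i, u 0 i != 0.
    apply/existsP; apply: contraNT u0; rewrite negb_exists => /forallP u0.
    by apply/eqP/rowP => i; have := u0 i; rewrite negbK mxE => /eqP.
  by exists (e i); rewrite e'e.
- by rewrite -[RHS]uw dw sumE; apply: eq_bigr => i _; rewrite e'e.
- by move=> x; rewrite AE uA mxE.
rewrite [X in mu * X]sumE [leRHS]sumE.
have -> : \sum_i f (e i) ^+ 2 = dotr F F by apply: eq_bigr => i _; rewrite mxE expr2.
apply: le_trans hu _; rewrite le_eqVlt; apply/orP; left; apply/eqP.
apply: eq_bigr => i _; rewrite [F 0 i]mxE; congr (_ * _).
rewrite -{1}(e'e i) -AE; apply: eq_bigr => y _; by rewrite mxE ee'.
Qed.

(** A matrix with more rows than columns has a nonzero left kernel. *)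
Lemma linear_dependence (F : fieldType) (T : finType) (A : {set T}) k (m : 'I_k -> T -> F) :
  (#|A| < k)%N ->
  exists2 v : 'I_k -> F, exists i, v i != 0 & forall a, a \in A -> \sum_i v i * m i a = 0.
Proof.
move=> Ak; pose M : 'M[F]_(k, #|A|) := \matrix_(i, j) m i (enum_val j).
have : kermx M != 0.
  rewrite kermx_eq0 /row_free; apply: contraTneq Ak => <-.
  by rewrite -leqNgt rank_leq_col.
move=> /rowV0Pn[v /sub_kermxP vM v0]; exists (v 0).
  apply/existsP; apply: contraNT v0 => /existsPn v0; apply/eqP/rowP => i.
  by have := v0 i; rewrite negbK mxE => /eqP.
move=> a aA; have /rowP/(_ (enum_rank_in aA a)) := vM; rewrite !mxE; apply: etrans.
by apply: eq_bigr => i _; rewrite mxE enum_rankK_in.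
Qed.

End Spectral.

Import Order.TTheory GRing.Theory Num.Theory.

(** * Word balls and the Dirichlet energy *)

Section WordBalls.
Local Open Scope ring_scope.
Variables (gT : finGroupType) (S : {set gT}).
Hypothesis symS : forall s, s \in S -> s^-1%g \in S.

(** Adjoining 1 to [S] makes the set powers increasing, so the [n]-th power contains all words of
    length at most [n]. *)
Definition wball n : {set gT} := ((1 |: S) ^+ n)%g.

Lemma wballD m n : wball (m + n) = (wball m * wball n)%g.
Proof. exact: expgD. Qed.

Lemma wball0 g : (g \in wball 0) = (g == 1%g).
Proof. by rewrite /wball expg0 inE. Qed.

Lemma wball1 g : (g \in wball 1) = (g == 1%g) || (g \in S).
Proof. by rewrite /wball expg1 !inE. Qed.

Lemma wball_1 n : 1%g \in wball n.
Proof.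
elim: n => [|n IH]; first by rewrite wball0.
by rewrite -addn1 wballD -(mulg1 1%g) mem_mulg // wball1 eqxx.
Qed.

Lemma wball_mul m n k g h :
  (m + n <= k)%N -> g \in wball m -> h \in wball n -> (g * h)%g \in wball k.
Proof.
move=> /subnKC <- gm hn; rewrite !wballD.
by rewrite -(mulg1 (g * h)%g) !mem_mulg ?wball_1.
Qed.

Lemma wball_sub m n : (m <= n)%N -> wball m \subset wball n.
Proof.
move=> mn; apply/subsetP => g gm; rewrite -(mulg1 g).
by apply: (wball_mul _ gm (wball_1 0)); rewrite addn0.
Qed.

Lemma wball_inv n g : (g^-1%g \in wball n) = (g \in wball n).
Proof.
suff inv h : h \in wball n -> h^-1%g \in wball n.
  by apply/idP/idP => /inv; rewrite ?invgK.
elim: n h => [|n IH] h; first by rewrite !wball0 => /eqP ->; rewrite invg1.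
rewrite -{1}addn1 wballD => /mulsgP[x s xn s1 ->]; rewrite invMg.
apply: (@wball_mul 1 n) => //; last exact: IH.
by move: s1; rewrite !wball1 => /orP[/eqP ->|/symS ->]; rewrite ?invg1 ?eqxx ?orbT.
Qed.

Lemma wballP n g :
  reflect (exists w : seq gT, [/\ all [in S] w, (size w <= n)%N & (\prod_(s <- w) s)%g = g])
          (g \in wball n).
Proof.
apply: (iffP idP) => [|[w [wS wn <-]]].
  elim: n g => [|n IH] g; first by rewrite wball0 => /eqP ->; exists [::]; rewrite big_nil.
  rewrite -addn1 addnC wballD => /mulsgP[s x s1 /IH[w [wS wn wx]] ->].
  move: s1; rewrite wball1 => /orP[/eqP ->|sS].
    by exists w; rewrite wS mul1g wx; split=> //; lia.
  by exists (s :: w); rewrite /= sS wS big_cons wx; split=> //; lia.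
apply: subsetP (wball_sub wn) _ _.
elim: w wS {wn} => [_|s w IH /= /andP[sS wS]]; first by rewrite big_nil wball_1.
by rewrite big_cons; apply: (@wball_mul 1 (size w)); rewrite ?wball1 ?sS ?orbT ?IH.
Qed.

Lemma wball_gen : <<S>>%g = [set: gT] -> exists n, wball n = [set: gT].
Proof. by move=> <-; have [n ->] := gen_expgs S; exists n. Qed.

Lemma mem_lball a x n : (x \in a *: wball n)%g = ((a^-1 * x)%g \in wball n).
Proof. by rewrite mem_lcoset. Qed.

Lemma wball_dist_sym x y n : ((x^-1 * y)%g \in wball n) = ((y^-1 * x)%g \in wball n).
Proof. by rewrite -wball_inv invMg invgK. Qed.

Lemma wball_triangle x y z m n k :
  (m + n <= k)%N -> (x^-1 * y)%g \in wball m -> (y^-1 * z)%g \in wball n ->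
  (x^-1 * z)%g \in wball k.
Proof. by move=> mnk xy yz; have := wball_mul mnk xy yz; rewrite mulgA mulgK. Qed.

(** * Separated nets: covering and packing *)

Definition separated r (A : {set gT}) :=
  [forall a in A, forall b in A, (a^-1 * b \in wball r)%g ==> (a == b)].

(** A maximal separated set works: a point at distance more than [r] from all of it could be
    added. *)
Lemma separated_cover r :
  exists2 A : {set gT}, separated r A
    & forall x, exists2 a, a \in A & (x \in a *: wball r)%g.
Proof.
have [A /maxsetP[sA mA]] : {A | maxset (separated r) A}.
  by apply: ex_maxset; exists set0; apply/forall_inP => a; rewrite inE.
exists A => // x; apply/exists_inP; apply: contraT => /exists_inPn nx.
have nx' a : a \in A -> (a^-1 * x)%g \notin wball r.
  by move=> /nx; rewrite mem_lball.
have xA : x \in A.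
  rewrite -(mA (x |: A)) ?setU11 ?subsetUr //.
  apply/forall_inP => a; rewrite !inE => /orP[/eqP ->|aA].
    apply/forall_inP => b; rewrite !inE => /orP[/eqP -> |bA]; first by rewrite eqxx implybT.
    by rewrite wball_dist_sym (negbTE (nx' b bA)).
  apply/forall_inP => b; rewrite !inE => /orP[/eqP -> |bA].
    by rewrite (negbTE (nx' a aA)).
  by move: sA => /forall_inP/(_ a aA)/forall_inP/(_ b bA).
by have := nx' x xA; rewrite mulVg wball_1.
Qed.

(** Balls of half the radius about separated points are disjoint, so multiplication is injective on
    [A] times such a ball. *)
Lemma separated_card r (A Y : {set gT}) :
  separated r A -> (forall a, a \in A -> (a *: wball r./2 \subset Y)%g) ->
  (#|A| * #|wball r./2| <= #|Y|)%N.
Proof.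
move=> sA AY; rewrite -cardsX -(@card_in_imset _ _ (fun p : gT * gT => p.1 * p.2)%g).
  apply/subset_leq_card/subsetP => _ /imsetP[[a b] /setXP[aA bB] ->] /=.
  by apply: (subsetP (AY a aA)); rewrite mem_lball mulKg.
move=> [a b] [a' b'] /setXP[/= aA bB] /setXP[/= aA' bB'] /= e.
suff aa : a = a' by move: e; rewrite aa => /mulgI ->.
apply/eqP; move: sA => /forall_inP/(_ a aA)/forall_inP/(_ a' aA')/implyP; apply.
have -> : (a^-1 * a' = b * b'^-1)%g.
  by apply: (mulgI a); rewrite mulKVg mulgA e mulgK.
by apply: (@wball_mul r./2 r./2); rewrite ?wball_inv //; lia.
Qed.

Lemma lball_card a n : #|(a *: wball n)%g| = #|wball n|.
Proof. exact: card_lcoset. Qed.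

(** * Dirichlet energy and Poincaré inequalities on balls *)

Section Energy.
Variable R : realFieldType.
Implicit Types f : gT -> R.

(** No normalisation by the degree. As [S] is symmetric, [energy] sees each edge from both ends,
    whence the factor 2 in [energy_lap]. *)
Definition grad2 f x : R := \sum_(s in S) (f (x * s)%g - f x) ^+ 2.
Definition energy f : R := \sum_x grad2 f x.

Lemma grad2_ge0 f x : 0 <= grad2 f x.
Proof. by apply: sumr_ge0 => s _; rewrite sqr_ge0. Qed.

Lemma energy_ge0 f : 0 <= energy f.
Proof. by apply: sumr_ge0 => x _; rewrite grad2_ge0. Qed.

(* Telescoping along a geodesic; passing from n to n + 1 uses
   n (a + b)^2 <= (n + 1) (a^2 + n b^2). *)
Lemma path_energy f n g (X Y : {set gT}) :
  g \in wball n -> (X * wball n \subset Y)%g ->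
  \sum_(x in X) (f (x * g)%g - f x) ^+ 2 <= n%:R ^+ 2 * \sum_(y in Y) grad2 f y.
Proof.
elim: n g => [|n IH] g.
  rewrite wball0 => /eqP -> _; rewrite expr0n mul0r big1 // => x _.
  by rewrite mulg1 subrr expr0n.
rewrite -{1}addn1 wballD => /mulsgP[h s hn s1 ->] XY.
have XY' : (X * wball n \subset Y)%g by apply: subset_trans XY; rewrite mulgS // wball_sub.
set E := \sum_(y in Y) _ in IH *.
have E0 : 0 <= E by apply: sumr_ge0 => y _; exact: grad2_ge0.
set a := fun x : gT => f (x * h)%g - f x.
set b := fun x : gT => f (x * h * s)%g - f (x * h)%g.
have hb : \sum_(x in X) b x ^+ 2 <= E.
  have : \sum_(x in X) b x ^+ 2 <= \sum_(x in X) grad2 f (x * h)%g.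
    apply: ler_sum => x _; move: s1; rewrite wball1 /b /grad2 => /orP[/eqP ->|sS].
      by rewrite mulg1 subrr expr0n grad2_ge0.
    by rewrite (bigD1 s) //= lerDl; apply: sumr_ge0 => t _; rewrite sqr_ge0.
  move=> /le_trans -> //.
  rewrite -(big_imset (grad2 f)) /=; last by move=> x y _ _ /mulIg.
  rewrite /E [leRHS](big_setID ((fun x => x * h)%g @: X)) /=.
  rewrite (setIidPr _); last first.
    apply/subsetP => _ /imsetP[x xX ->]; apply: (subsetP XY').
    exact: mem_mulg.
  by rewrite lerDl; apply: sumr_ge0 => y _; exact: grad2_ge0.
have ha : \sum_(x in X) a x ^+ 2 <= n%:R ^+ 2 * E by exact: IH.
have -> : \sum_(x in X) (f (x * (h * s))%g - f x) ^+ 2 = \sum_(x in X) (a x + b x) ^+ 2.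
  by apply: eq_bigr => x _; rewrite mulgA /a /b; congr (_ ^+ 2); ring.
(* The weighted inequality is multiplied through by [n], so [n = 0] is separate: there [h] is 1 and
   [a] vanishes. *)
case: n => [|n] in IH hn ha XY XY' *.
  move: hn; rewrite wball0 => /eqP h1.
  rewrite expr1n mul1r; apply: le_trans hb; apply: ler_sum => x _.
  by rewrite /a h1 mulg1 subrr add0r.
have N0 : 0 < n.+1%:R :> R by rewrite ltr0n.
rewrite -(ler_pM2l N0).
apply: (@le_trans _ _ (n.+2%:R * \sum_(x in X) a x ^+ 2 + n.+1%:R * n.+2%:R * \sum_(x in X) b x ^+ 2)).
  rewrite !mulr_sumr -big_split; apply: ler_sum => x _ /=.
  rewrite -subr_ge0.
  have -> : n.+2%:R * a x ^+ 2 + n.+1%:R * n.+2%:R * b x ^+ 2 - n.+1%:R * (a x + b x) ^+ 2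
     = (a x - n.+1%:R * b x) ^+ 2 by rewrite -natr1; ring.
  exact: sqr_ge0.
have -> : n.+1%:R * (n.+2%:R ^+ 2 * E)
  = n.+2%:R * (n.+1%:R ^+ 2 * E) + n.+1%:R * n.+2%:R * E by rewrite -[n.+2%:R]natr1; ring.
by rewrite lerD // ler_wpM2l // mulr_ge0 ?ltW.
Qed.

Lemma sum_sqr_diff (X : {set gT}) f :
  \sum_(x in X) \sum_(y in X) (f y - f x) ^+ 2
  = 2 * #|X|%:R * (\sum_(x in X) f x ^+ 2) - 2 * (\sum_(x in X) f x) ^+ 2.
Proof.
have -> : \sum_(x in X) \sum_(y in X) (f y - f x) ^+ 2
  = \sum_(x in X) (\sum_(y in X) f y ^+ 2 + #|X|%:R * f x ^+ 2
      + (- 2 * \sum_(y in X) f y) * f x).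
  apply: eq_bigr => x _.
  rewrite mulr_natl -sumr_const mulr_sumr mulr_suml -!big_split.
  by apply: eq_bigr => y _ /=; ring.
rewrite !big_split /= sumr_const -mulr_natl -!mulr_sumr; ring.
Qed.

(** Mean zero turns the sum of squared differences over pairs into [2 * #|X|] times the left side.
    Each pair is [x], [x * g] with [g] of length at most [2r]; [path_energy] costs [(2r)^2] for each
    [g], along paths inside the ball of radius [3r], and the ratio of volumes is at most [c]. *)
Lemma ball_poincare c a r f :
  #|wball (r + r)|%:R <= c * #|wball r|%:R ->
  \sum_(x in (a *: wball r)%g) f x = 0 ->
  \sum_(x in (a *: wball r)%g) f x ^+ 2
    <= 2 * c * r%:R ^+ 2 * \sum_(x in (a *: wball (r + r + r))%g) grad2 f x.
Proof.
move=> hc f0; set X := (a *: wball r)%g in f0 *; set E := \sum_(x in _) grad2 f x.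
have E0 : 0 <= E by apply: sumr_ge0 => y _; exact: grad2_ge0.
have := sum_sqr_diff X f; rewrite f0 expr0n mulr0 subr0 => eX.
have cX : #|X| = #|wball r| by exact: lball_card.
have X0 : 0 < #|X|%:R :> R.
  by rewrite ltr0n cX; apply/card_gt0P; exists 1%g; exact: wball_1.
have : 2 * #|X|%:R * (\sum_(x in X) f x ^+ 2)
    <= #|wball (r + r)|%:R * ((r + r)%:R ^+ 2 * E).
  rewrite -eX.
  apply: (@le_trans _ _ (\sum_(x in X) \sum_(g in wball (r + r)) (f (x * g)%g - f x) ^+ 2)).
    apply: ler_sum => x xX.
    have -> : \sum_(g in wball (r + r)) (f (x * g)%g - f x) ^+ 2
       = \sum_(y in (x *: wball (r + r))%g) (f y - f x) ^+ 2.
      by rewrite -lcosetE big_imset //= => y z _ _ /mulgI.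
    rewrite [leRHS](big_setID X) /= (setIidPr _).
      by rewrite lerDl; apply: sumr_ge0 => y _; exact: sqr_ge0.
    apply/subsetP => y; rewrite !mem_lball => yX; move: xX; rewrite mem_lball => xX.
    by rewrite wball_dist_sym in xX; apply: wball_triangle xX yX.
  rewrite exchange_big /= mulr_natl -sumr_const; apply: ler_sum => g gr.
  apply: path_energy => //; apply/subsetP => _ /mulsgP[x h + hr ->].
  rewrite !mem_lball => xr; rewrite mulgA; apply: wball_mul xr hr; lia.
move=> h0.
have : 2 * #|X|%:R * (\sum_(x in X) f x ^+ 2) <= c * #|wball r|%:R * ((r + r)%:R ^+ 2 * E).
  by apply: le_trans h0 _; apply: ler_wpM2r hc; rewrite mulr_ge0 // sqr_ge0.
rewrite -cX => h.
rewrite -(ler_pM2l X0) -(ler_pM2l (ltr0Sn R 1)) mulrA; apply: le_trans h _.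
by rewrite le_eqVlt; apply/orP; left; apply/eqP; rewrite natrD; ring.
Qed.

Variable c : R.
(** Halving rounds down, so small radii carry information: [k = 0] gives [1 <= c], and [k = 1]
    compares [1 |: S] with a point and bounds the degree. *)
Hypothesis doubling : forall k, #|wball k|%:R <= c * #|wball k./2|%:R.

Lemma wball_card_gt0 n : 0 < #|wball n|%:R :> R.
Proof. by rewrite ltr0n; apply/card_gt0P; exists 1%g; exact: wball_1. Qed.

Lemma doubling_ge1 : 1 <= c.
Proof. by have := doubling 0; rewrite ler_pMl // wball_card_gt0. Qed.

Lemma doubling_iter k n : #|wball n|%:R <= c ^+ k * #|wball (iter k half n)|%:R.
Proof.
elim: k => [|k IH]; first by rewrite mul1r.
apply: le_trans IH _; rewrite exprSr -mulrA; apply: ler_wpM2l (doubling _).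
by rewrite exprn_ge0 // (le_trans ler01) // doubling_ge1.
Qed.

Lemma card_gens : #|S|%:R <= c.
Proof.
have := doubling 1.
have -> : #|wball 0| = 1%N by rewrite /wball expg0 cards1.
rewrite mulr1; apply: le_trans; rewrite ler_nat subset_leq_card //.
by apply/subsetP => s sS; rewrite wball1 sS orbT.
Qed.

(** The local inequalities are summed over the net. A factor [c] comes from each of them, and
    [c ^+ 3] bounds how many balls of radius [3r] overlap at a point. *)
Lemma separated_net_poincare r (A : {set gT}) f :
  separated r A -> (forall x, exists2 a, a \in A & (x \in a *: wball r)%g) ->
  (forall a, a \in A -> \sum_(x in (a *: wball r)%g) f x = 0) ->
  \sum_x f x ^+ 2 <= 2 * c ^+ 4 * r%:R ^+ 2 * energy f.
Proof.
move=> sA cA fA.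
have c0 : 0 <= c by rewrite (le_trans ler01) // doubling_ge1.
apply: (@le_trans _ _ (\sum_(a in A) \sum_(x in (a *: wball r)%g) f x ^+ 2)).
  under [leRHS]eq_bigr do rewrite big_mkcond /=.
  rewrite exchange_big; apply: ler_sum => x _ /=.
  have [a aA xa] := cA x; rewrite (bigD1 a) //= xa lerDl.
  by apply: sumr_ge0 => b _; case: ifP => // _; exact: sqr_ge0.
apply: (@le_trans _ _ (\sum_(a in A) 2 * c * r%:R ^+ 2 *
    \sum_(x in (a *: wball (r + r + r))%g) grad2 f x)).
  apply: ler_sum => a aA; apply: ball_poincare (fA a aA).
  by have := doubling (r + r); rewrite addnn doubleK.
rewrite -mulr_sumr.
have -> : 2 * c ^+ 4 * r%:R ^+ 2 * energy f = 2 * c * r%:R ^+ 2 * (c ^+ 3 * energy f) by ring.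
apply: ler_wpM2l; first by rewrite !mulr_ge0 ?sqr_ge0.
under eq_bigr do rewrite big_mkcond /=.
rewrite exchange_big mulr_sumr; apply: ler_sum => z _ /=.
rewrite -big_mkcondr /= sumr_const -mulr_natl; apply: ler_wpM2r; first exact: grad2_ge0.
(* Overlap at [z]: the centres lie within [3r] of [z], so their disjoint balls of radius [r./2] fit
   into the ball of radius [4r] about [z]; three halvings of [4r] give [r./2]. *)
rewrite -(ler_pM2r (wball_card_gt0 r./2)).
have := doubling_iter 3 (4 * r).
have -> : iter 3 half (4 * r) = r./2 by rewrite /=; lia.
apply: le_trans; rewrite -natrM ler_nat.
set Az := [set a in A | (z \in a *: wball (r + r + r))%g].
have -> : #|[pred a in A | (z \in a *: wball (r + r + r))%g]| = #|Az|.
  by apply: eq_card => a; rewrite !inE.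
rewrite -(lball_card z (4 * r)); apply: (separated_card (r := r)).
  apply/forall_inP => a; rewrite inE => /andP[aA _].
  apply/forall_inP => b; rewrite inE => /andP[bA _].
  by move: sA => /forall_inP/(_ a aA)/forall_inP/(_ b bA).
move=> a; rewrite inE mem_lball => /andP[_ az]; apply/subsetP => x; rewrite !mem_lball => xa.
by rewrite wball_dist_sym in az; apply: wball_triangle az xa; lia.
Qed.

(** * The diameter, and a test function of small energy *)

Lemma word_diameter : <<S>>%g = [set: gT] -> (1 < #|gT|)%N ->
  exists D y, wball D.+1 = [set: gT] /\ y \notin wball D.
Proof.
move=> /wball_gen[n nT] G1.
have ex : exists n, wball n == [set: gT] by exists n; exact/eqP.
(* The least radius covering the group is positive because the group is nontrivial; the diameter is
   thus written [D.+1]. *)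
case: (ex_minnP ex) => -[|D] /eqP DT Dmin.
  by move: G1; rewrite -cardsT -DT /wball expg0 cards1.
have : wball D != [set: gT] by apply/negP => /Dmin; rewrite ltnn.
rewrite -subTset => /subsetPn[y _ yD].
by exists D, y.
Qed.

(** Packing uses half of the separation radius, hence one doubling beyond the [k] halvings. *)
Lemma separated_net_card D k A :
  wball D = [set: gT] -> separated (iter k half D) A -> #|A|%:R <= c ^+ k.+1.
Proof.
move=> DT sA; have /= := separated_card sA (fun a _ => subsetT _).
rewrite -DT -(ler_nat R) natrM => h.
rewrite -(ler_pM2r (wball_card_gt0 (iter k half D)./2)).
exact: le_trans h (doubling_iter k.+1 D).
Qed.

Lemma iter_half_le k D : (iter k half D * 2 ^ k <= D)%N.
Proof.
elim: k => [|k IH]; first by rewrite muln1.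
apply: leq_trans IH; rewrite /= expnS mulnA leq_mul2r; apply/orP; right.
by rewrite -[leqRHS]odd_double_half -muln2 leq_addl.
Qed.

(* This is max (0, r - |x|) in terms of the word length |x|. *)
Definition bump_fun r (x : gT) : nat := \sum_(j < r) (x \in wball j).

Lemma bump_fun_le r x s : s \in S -> (bump_fun r (x * s)%g <= bump_fun r x + 1)%N.
Proof.
move=> sS; case: r => [|r]; first by rewrite /bump_fun !big_ord0.
rewrite /bump_fun big_ord_recr [in leqRHS]big_ord_recl /=.
rewrite leq_add ?leq_b1 // -[leqLHS]add0n leq_add //; apply: leq_sum => j _.
rewrite /bump /= add1n; case xs : (_ \in _) => //.
suff -> : x \in wball j.+1 by [].
rewrite -(mulgK s x); apply: (@wball_mul j 1) xs _; first lia.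
by rewrite wball_inv wball1 sS orbT.
Qed.

Lemma bump_fun_out r x : x \notin wball r.-1 -> bump_fun r x = 0%N.
Proof.
move=> xr; rewrite /bump_fun big1 // => j _; apply/eqP; rewrite eqb0.
by apply: contra xr; apply/subsetP/wball_sub; have := ltn_ord j; lia.
Qed.

Lemma bump_fun_in r i x : x \in wball i -> (r <= bump_fun r x + i)%N.
Proof.
move=> xi.
elim: r => [//|r IH]; rewrite /bump_fun big_ord_recr /=.
case: (leqP i r) => [ir|ri]; last by rewrite -/(bump_fun r x); lia.
by rewrite (subsetP (wball_sub ir)) // -/(bump_fun r x); lia.
Qed.

Lemma energy_lmul f y : energy (fun x => f (y * x)%g) = energy f.
Proof.
rewrite [RHS](reindex_inj (mulgI y)); apply: eq_bigr => x _.
by apply: eq_bigr => s _; rewrite mulgA.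
Qed.

Lemma energyB f h : energy (fun x => f x - h x) <= 2 * energy f + 2 * energy h.
Proof.
rewrite !mulr_sumr -big_split; apply: ler_sum => x _ /=.
rewrite !mulr_sumr -big_split; apply: ler_sum => s _ /=.
rewrite -subr_ge0; set u := f _; set v := f x; set w := h _; set z := h x.
have -> : 2 * (u - v) ^+ 2 + 2 * (w - z) ^+ 2 - (u - w - (v - z)) ^+ 2
  = (u - v + (w - z)) ^+ 2 by ring.
exact: sqr_ge0.
Qed.

(** The bump is 1-Lipschitz along edges and its gradient vanishes outside the ball of radius [r]. *)
Lemma energy_bump r : energy (fun x => (bump_fun r x)%:R) <= #|S|%:R * #|wball r|%:R.
Proof.
case: r => [|r].
  rewrite /energy big1 ?mulr_ge0 // => x _; apply: big1 => s _.
  by rewrite /bump_fun !big_ord0 subrr expr0n.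
rewrite mulrC mulr_natl -sumr_const [leRHS]big_mkcond; apply: ler_sum => x _.
case: ifPn => xr; last first.
  rewrite le_eqVlt; apply/orP; left; apply/eqP/big1 => s sS.
  rewrite !bump_fun_out ?subrr ?expr0n //.
    by apply: contra xr; apply/subsetP/wball_sub.
  apply: contra xr => /= xs; rewrite -(mulgK s x); apply: (@wball_mul r 1) xs _; first lia.
  by rewrite wball_inv wball1 sS orbT.
rewrite -sum1_card natr_sum; apply: ler_sum => s sS.
have := bump_fun_le r.+1 x sS; have := bump_fun_le r.+1 (x * s) (symS sS); rewrite mulgK.
rewrite -2!(ler_nat R) !natrD; move: (_%:R) (_%:R) => u v; nra.
Qed.

Lemma small_energy_function D y :
  y \notin wball D ->
  exists f, [/\ exists x, f x != 0, \sum_x f x = 0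
    & energy f * D.+1%:R ^+ 2 <= 32 * c * #|S|%:R * \sum_x f x ^+ 2].
Proof.
(* With [r] the half of [D.+1] rounded up, [2 * (r - 1) <= D] keeps the supports about 1 and [y]
   disjoint, while [D.+1 <= 2 * r] keeps the bump wide. *)
move=> yD; pose r := uphalf D.+1.
pose p x : R := (bump_fun r x)%:R.
have p0 x : 0 <= p x by exact: ler0n.
have r0 : (0 < r)%N by rewrite /r; lia.
have disj x : p x * p (y^-1 * x)%g = 0.
  apply/eqP; apply: contraNT yD; rewrite mulf_eq0 negb_or => /andP[px py].
  have inr z : p z != 0 -> z \in wball r.-1.
    by apply: contraNT => /bump_fun_out pz; rewrite /p pz.
  have := inr _ px; rewrite -wball_inv => x1; have := wball_mul (leqnn _) (inr _ py) x1.
  rewrite mulgK wball_inv; apply/subsetP/wball_sub; rewrite /r; lia.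
exists (fun x => p x - p (y^-1 * x)%g).
have sp2 : \sum_x (p x - p (y^-1 * x)%g) ^+ 2 = 2 * \sum_x p x ^+ 2.
  have -> : \sum_x (p x - p (y^-1 * x)%g) ^+ 2 = \sum_x p x ^+ 2 + \sum_x p (y^-1 * x)%g ^+ 2.
    rewrite -big_split; apply: eq_bigr => x _ /=.
    transitivity (p x ^+ 2 + p (y^-1 * x)%g ^+ 2 - 2 * (p x * p (y^-1 * x)%g)); first ring.
    by rewrite disj mulr0 subr0.
  rewrite [X in _ + X](_ : _ = \sum_x p x ^+ 2); first by ring.
  by rewrite [RHS](reindex_inj (mulgI (y^-1)%g)).
split.
- exists 1%g; have p1 : p 1%g != 0.
    by rewrite /p pnatr_eq0; have := bump_fun_in r (wball_1 0); lia.
  have := disj 1%g => /eqP; rewrite mulf_eq0 (negbTE p1) /= => /eqP ->.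
  by rewrite subr0.
- by rewrite sumrB [X in X - _](reindex_inj (mulgI (y^-1)%g)) subrr.
rewrite sp2.
have E1 := energyB p (fun x => p (y^-1 * x)%g); rewrite energy_lmul in E1.
have E2 : energy p <= #|S|%:R * #|wball r|%:R by exact: energy_bump.
(* On the ball of radius [r./2] the bump is at least [r / 2]; doubling then compares this ball with
   the support. *)
have low : r%:R ^+ 2 * #|wball r./2|%:R <= 4 * \sum_x p x ^+ 2.
  rewrite mulr_natr -sumr_const mulr_sumr [leLHS]big_mkcond /=; apply: ler_sum => x _.
  case: ifP => [xr|_]; last by rewrite mulr_ge0 ?sqr_ge0.
  have : r%:R <= 2 * p x.
    by rewrite /p -natrM ler_nat; have := bump_fun_in r xr; lia.
  by have := p0 x; have : 0 <= r%:R :> R by []; nra.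
have Dr : D.+1%:R <= 2 * r%:R :> R by rewrite -natrM ler_nat /r; lia.
have D2 : D.+1%:R ^+ 2 <= 4 * r%:R ^+ 2 :> R.
  have -> : 4 * r%:R ^+ 2 = (2 * r%:R) ^+ 2 :> R by ring.
  by rewrite ler_sqr ?nnegrE ?mulr_ge0.
set Ef := energy _ in E1 *.
have Ef0 : 0 <= Ef by exact: energy_ge0.
have c0 : 0 <= c by rewrite (le_trans ler01) // doubling_ge1.
have S0 : 0 <= #|S|%:R :> R by [].
apply: (@le_trans _ _ (4 * (#|S|%:R * (c * #|wball r./2|%:R)) * (4 * r%:R ^+ 2))).
  apply: ler_pM => //; first exact: sqr_ge0.
  have : #|S|%:R * #|wball r|%:R <= #|S|%:R * (c * #|wball r./2|%:R).
    by apply: ler_wpM2l (doubling r).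
  by move: E1 E2; lra.
have -> : 4 * (#|S|%:R * (c * #|wball r./2|%:R)) * (4 * r%:R ^+ 2)
  = 16 * c * #|S|%:R * (r%:R ^+ 2 * #|wball r./2|%:R) by ring.
have -> : 32 * c * #|S|%:R * (2 * \sum_x p x ^+ 2)
  = 16 * c * #|S|%:R * (4 * \sum_x p x ^+ 2) by ring.
by apply: ler_wpM2l low; rewrite !mulr_ge0.
Qed.

(** * The Laplacian and Poincaré inequalities for its eigenfunctions *)

Definition lap f x : R := f x - #|S|%:R^-1 * \sum_(s in S) f (x * s)%g.

Lemma lap_lin n mu (a : 'I_n -> R) (F : 'I_n -> gT -> R) :
  (forall i x, lap (F i) x = mu * F i x) ->
  forall x, lap (fun y => \sum_i a i * F i y) x = mu * \sum_i a i * F i x.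
Proof.
move=> eF x; rewrite /lap exchange_big /= [in LHS]mulr_sumr -sumrB [RHS]mulr_sumr.
apply: eq_bigr => i _; rewrite -mulr_sumr [RHS]mulrCA -eF /lap mulrBr.
by congr (_ - _); rewrite mulrCA.
Qed.

Lemma gens_gt0 : <<S>>%g = [set: gT] -> (1 < #|gT|)%N -> 0 < #|S|%:R :> R.
Proof.
move=> genS G1; rewrite ltr0n card_gt0; apply: contraTneq G1 => S0.
by rewrite -cardsT -genS S0 gen0 cards1.
Qed.

(** Summation by parts: expand the squares and translate the sum of [f (x * s)%g ^+ 2] back by
    [s]. *)
Lemma energy_lap f : 0 < #|S|%:R :> R ->
  energy f = 2 * #|S|%:R * \sum_x lap f x * f x.
Proof.
move=> d0; rewrite mulr_sumr.
have -> : energy f = \sum_x (\sum_(s in S) f (x * s)%g ^+ 2 + #|S|%:R * f x ^+ 2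
    - 2 * f x * \sum_(s in S) f (x * s)%g).
  apply: eq_bigr => x _.
  rewrite mulr_natl -sumr_const mulr_sumr -sumrN -!big_split.
  by apply: eq_bigr => s _ /=; ring.
rewrite !big_split /= exchange_big /=.
have -> : \sum_(s in S) \sum_x f (x * s)%g ^+ 2 = \sum_x #|S|%:R * f x ^+ 2.
  rewrite -mulr_sumr mulr_natl -sumr_const; apply: eq_bigr => s _.
  by rewrite [RHS](reindex_inj (mulIg s)).
rewrite -!big_split; apply: eq_bigr => x _ /=; rewrite /lap; field.
exact: lt0r_neq0.
Qed.

Lemma energy_eigen mu f : 0 < #|S|%:R :> R -> (forall x, lap f x = mu * f x) ->
  energy f = 2 * #|S|%:R * mu * \sum_x f x ^+ 2.
Proof.
move=> d0 ef; rewrite energy_lap // -[RHS]mulrA [X in _ = _ * X]mulr_sumr; congr (_ * _).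
by apply: eq_bigr => x _; rewrite ef; ring.
Qed.

Lemma sqr_sum_eq0 (T : finType) (f : T -> R) : \sum_x f x ^+ 2 = 0 -> forall x, f x = 0.
Proof.
move=> /eqP; rewrite psumr_eq0 => [/allP f0 x|i _]; last exact: sqr_ge0.
by have := f0 x (mem_index_enum x); rewrite sqrf_eq0 => /eqP.
Qed.

Lemma sum_sqr_gt0 (T : finType) (f : T -> R) x : f x != 0 -> 0 < \sum_y f y ^+ 2.
Proof.
move=> fx; rewrite lt_def sumr_ge0 => [|y _]; last exact: sqr_ge0.
by rewrite andbT; apply: contraNneq fx => /sqr_sum_eq0 ->.
Qed.

(** For nonzero [f] the net inequality and [#|S| <= c] give [1 <= 4 c^5 t], where [t = r^2 mu]. As
    [r * 2 ^ k <= D], this leads to the contradiction [16 c <= 64 c^6 t < 4^k t <= mu D^2 <= 16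
    c]. *)
Lemma eigen_vanish D k mu (A : {set gT}) f :
  0 < #|S|%:R :> R -> (0 < D)%N -> mu * D%:R ^+ 2 <= 16 * c -> 8 * c ^+ 3 < 2 ^+ k ->
  separated (iter k half D) A ->
  (forall x, exists2 a, a \in A & (x \in a *: wball (iter k half D))%g) ->
  (forall x, lap f x = mu * f x) ->
  (forall a, a \in A -> \sum_(x in (a *: wball (iter k half D))%g) f x = 0) ->
  forall x, f x = 0.
Proof.
move=> d0 D0 hmu hk sA cA ef fA; apply: sqr_sum_eq0.
have := separated_net_poincare sA cA fA; rewrite (energy_eigen d0 ef).
set r := iter k half D; set N := \sum_x _ => hN.
have N0 : 0 <= N by apply: sumr_ge0 => x _; exact: sqr_ge0.
apply/eqP; rewrite eq_le N0 andbT leNgt; apply/negP => Npos.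
have c1 := doubling_ge1; have dc := card_gens.
have d1 : 0 <= #|S|%:R :> R by exact: ltW.
set t := r%:R ^+ 2 * mu.
have h1 : 1 <= 4 * c ^+ 4 * #|S|%:R * t.
  rewrite -(ler_pM2r Npos) mul1r; apply: le_trans hN _.
  by rewrite le_eqVlt; apply/orP; left; apply/eqP; rewrite /t; ring.
have c4 : 0 <= c ^+ 4 by rewrite exprn_ge0 // (le_trans ler01).
have t0 : 0 < t.
  rewrite ltNge; apply/negP => t0.
  have : 4 * c ^+ 4 * #|S|%:R * t <= 0.
    by apply: mulr_ge0_le0 => //; apply: mulr_ge0 => //; apply: mulr_ge0.
  lra.
have mu0 : 0 < mu.
  rewrite ltNge; apply/negP => mu0; have : t <= 0 by rewrite mulr_ge0_le0 ?sqr_ge0.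
  by rewrite leNgt t0.
have h2 : 16 * c <= 64 * c ^+ 6 * t.
  have : 4 * c ^+ 4 * #|S|%:R * t <= 4 * c ^+ 4 * c * t.
    by apply: ler_wpM2r; [exact: ltW | apply: ler_wpM2l => //; rewrite mulr_ge0].
  move=> h; have h3 : 1 <= 4 * c ^+ 4 * c * t by exact: le_trans h1 h.
  have -> : 64 * c ^+ 6 * t = 16 * c * (4 * c ^+ 4 * c * t) by ring.
  by rewrite ler_peMr // mulr_ge0 // (le_trans ler01).
have h3 : 64 * c ^+ 6 * t < (2 ^+ k) ^+ 2 * t.
  rewrite ltr_pM2r //.
  have -> : 64 * c ^+ 6 = (8 * c ^+ 3) ^+ 2 by ring.
  by rewrite ltr_sqr ?nnegrE ?exprn_ge0 // mulr_ge0 // exprn_ge0 // (le_trans ler01).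
have h4 : (2 ^+ k) ^+ 2 * t <= mu * D%:R ^+ 2.
  have -> : (2 ^+ k) ^+ 2 * t = mu * (r%:R * 2 ^+ k) ^+ 2 by rewrite /t; ring.
  rewrite ler_pM2l // ler_sqr ?nnegrE ?mulr_ge0 ?exprn_ge0 //.
  by rewrite -natrX -natrM ler_nat iter_half_le.
by have := lt_le_trans (le_lt_trans h2 h3) (le_trans h4 hmu); rewrite ltxx.
Qed.

(** A global Poincaré inequality: all pairs are [x], [x * g], and for this [f] each [g] may be
    replaced by some [h] of length at most [n], so [n] takes the place of the diameter. *)
Lemma eigen_lower_bound n mu f x0 x1 :
  0 < #|S|%:R :> R -> (forall x, lap f x = mu * f x) -> f x0 != f x1 ->
  (forall g, exists2 h, h \in wball n & forall x, f (x * g)%g = f (x * h)%g) ->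
  0 < mu /\ 1 <= n%:R ^+ 2 * c * mu.
Proof.
move=> d0 ef f01 hn.
have eE := energy_eigen d0 ef.
set N := \sum_x _ in eE.
have N0 : 0 <= N by apply: sumr_ge0 => x _; exact: sqr_ge0.
have G0 : 0 < #|[set: gT]|%:R :> R.
  by rewrite ltr0n; apply/card_gt0P; exists 1%g.
have sT (h : gT -> R) : \sum_(x in [set: gT]) h x = \sum_x h x.
  by apply: eq_bigl => x; rewrite inE.
have key : \sum_(x in [set: gT]) \sum_(y in [set: gT]) (f y - f x) ^+ 2
    <= #|[set: gT]|%:R * (n%:R ^+ 2 * energy f).
  have -> : \sum_(x in [set: gT]) \sum_(y in [set: gT]) (f y - f x) ^+ 2
     = \sum_(g in [set: gT]) \sum_(x in [set: gT]) (f (x * g)%g - f x) ^+ 2.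
    rewrite [RHS]exchange_big /=; apply: eq_bigr => x _.
    by rewrite (reindex_inj (mulgI x)); apply: eq_bigl => y; rewrite !inE.
  rewrite mulr_natl -sumr_const; apply: ler_sum => g _.
  have [h hh gh] := hn g.
  have := @path_energy f n h setT setT hh (subsetT _).
  by under eq_bigr do rewrite -gh; rewrite (sT (grad2 f)).
rewrite sum_sqr_diff in key.
rewrite !sT -/N in key.
(* The pair [x0], [x1] makes the variance positive. This yields [0 < mu] first, from which mean zero
   is deduced afterwards. *)
have diff : 0 < 2 * #|[set: gT]|%:R * N - 2 * (\sum_x f x) ^+ 2.
  have := sum_sqr_diff setT f; rewrite !sT -/N => <-.
  rewrite (bigD1 x0) //= (bigD1 x1) //= -addrA ltr_pwDl //.
    by rewrite lt_def sqr_ge0 sqrf_eq0 subr_eq0 eq_sym f01.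
  rewrite addr_ge0 //; apply: sumr_ge0 => x _; rewrite ?sqr_ge0 //.
  by apply: sumr_ge0 => y _; exact: sqr_ge0.
have En : 0 < n%:R ^+ 2 * energy f by have := lt_le_trans diff key; rewrite pmulr_rgt0.
have muN : 0 < n%:R ^+ 2 * mu * N.
  have e : n%:R ^+ 2 * energy f = (2 * #|S|%:R) * (n%:R ^+ 2 * mu * N) by rewrite eE; ring.
  by move: En; rewrite e pmulr_rgt0 // mulr_gt0.
have Np : 0 < N by rewrite lt_def N0 andbT; apply: contraTneq muN => ->; rewrite mulr0 ltxx.
have nmu : 0 < n%:R ^+ 2 * mu by move: muN; rewrite pmulr_lgt0.
have n2 : 0 < n%:R ^+ 2 :> R.
  by rewrite lt_def sqr_ge0 andbT; apply: contraTneq nmu => ->; rewrite mul0r ltxx.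
have mu0 : 0 < mu by move: nmu; rewrite pmulr_rgt0.
split=> //.
(* The Laplacian of any function sums to zero, and [mu] is nonzero. *)
have f0 : \sum_x f x = 0.
  apply: (mulfI (lt0r_neq0 mu0)); rewrite mulr0 mulr_sumr.
  under eq_bigr do rewrite -ef.
  rewrite sumrB -mulr_sumr exchange_big /=.
  have -> : \sum_(s in S) \sum_x f (x * s)%g = #|S|%:R * \sum_x f x.
    rewrite mulr_natl -sumr_const; apply: eq_bigr => s _.
    by rewrite [RHS](reindex_inj (mulIg s)).
  by rewrite mulrA mulVf ?mul1r ?subrr // lt0r_neq0.
move: key; rewrite f0 expr0n mulr0 subr0 eE => key.
have h : 1 <= n%:R ^+ 2 * #|S|%:R * mu.
  rewrite -(ler_pM2r Np) -(ler_pM2l G0) -(ler_pM2l (ltr0Sn R 1)) mul1r mulrA.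
  apply: le_trans key _.
  by rewrite le_eqVlt; apply/orP; left; apply/eqP; ring.
apply: le_trans h _; apply: ler_wpM2r; first exact: ltW.
by apply: ler_wpM2l card_gens; exact: ltW.
Qed.

End Energy.
End WordBalls.

(** * Short words for classes, and the variational principle for the Laplacian *)

Section Quotient.
Local Open Scope ring_scope.
Variables (gT : finGroupType) (S : {set gT}).
Notation wball := (wball S).

(* Along a shortest word representing a class, all prefixes lie in different
   classes. *)
Lemma class_word_length (T : finType) (cl : gT -> T) g :
  <<S>>%g = [set: gT] ->
  (forall x y z, cl x = cl y -> cl (x * z)%g = cl (y * z)%g) ->
  exists2 h, h \in wball #|[set cl x | x : gT]| & cl h = cl g.
Proof.
move=> /wball_gen[N NT] clM.
have ex : exists m, [exists h in wball m, cl h == cl g].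
  by exists N; apply/exists_inP; exists g; rewrite // NT inE.
case: (ex_minnP ex) => m /exists_inP[h hm /eqP hg] mmin.
suff mle : (m <= #|[set cl x | x : gT]|)%N.
  by exists h => //; apply: subsetP (wball_sub S mle) _ hm.
(* [new i] selects elements of length at most [i] whose class meets no smaller ball; one for each
   [i < m] gives [m] distinct classes. *)
pose new i := [pred x in wball i | [forall j : 'I_i, forall k in wball j, cl k != cl x]].
have newP (i : 'I_m) : exists x, new i x.
  have im : (i + (m - i) = m)%N by have := ltn_ord i; lia.
  have /mulsgP[x t xi tm ht] : h \in (wball i * wball (m - i))%g by rewrite -wballD im.
  exists x; rewrite /= xi; apply/forallP => j; apply/forall_inP => k kj.
  (* If a shorter [k] had the class of the prefix [x], then [k * t] would represent the class of [g]
     with fewer than [m] letters. *)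
  apply/eqP => kx; have := mmin (j + (m - i))%N.
  have -> : [exists h0 in wball (j + (m - i)), cl h0 == cl g].
    apply/exists_inP; exists (k * t)%g; first by rewrite wballD mem_mulg.
    by rewrite -hg ht; apply/eqP/clM.
  by move=> /(_ isT); have := ltn_ord j; lia.
pose F (i : 'I_m) := cl (xchoose (newP i)).
have Fneq (i j : 'I_m) : (i < j)%N -> F i != F j.
  move=> ij; have /andP[xi _] := xchooseP (newP i).
  have /andP[_ /forallP/(_ (Ordinal ij))/forall_inP] := xchooseP (newP j).
  by apply.
have Finj : injective F.
  move=> i j Fij; apply: val_inj; case: (ltngtP i j) => // /Fneq; by rewrite Fij eqxx.
rewrite -[leqLHS]card_ord -(card_imset _ Finj); apply/subset_leq_card/subsetP => _ /imsetP[i _ ->].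
exact: imset_f.
Qed.

(** The kernel [a] of the Laplacian is symmetric because [S] is closed under inverses, and has zero
    row sums because constants are harmonic; summation by parts turns the quadratic form into the
    energy. *)
Lemma lap_rayleigh (R : realType) (f : gT -> R) :
  (forall s, s \in S -> s^-1%g \in S) -> 0 < #|S|%:R :> R ->
  (exists x, f x != 0) -> \sum_x f x = 0 ->
  exists u mu, [/\ exists x, u x != 0, \sum_x u x = 0,
    forall x, lap S u x = mu * u x
    & mu * (2 * #|S|%:R) * \sum_x f x ^+ 2 <= energy S f].
Proof.
move=> symS d0 fn0 f0.
pose a (x y : gT) : R := (x == y)%:R - #|S|%:R^-1 * (x^-1 * y \in S)%g%:R.
have aE v x : \sum_y a x y * v y = lap S v x.
  rewrite /a /lap; under eq_bigr do rewrite mulrBl -mulrA.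
  rewrite sumrB -mulr_sumr; congr (_ - _ * _).
    rewrite (bigD1 x) //= eqxx mul1r big1 ?addr0 // => y yx.
    by rewrite eq_sym (negbTE yx) mul0r.
  rewrite (reindex_inj (mulgI x)) [RHS]big_mkcond; apply: eq_bigr => s _ /=.
  by rewrite mulKg; case: (s \in S); rewrite ?mul1r ?mul0r.
have [||//|//|u [mu [u0 su eu hu]]] := @rayleigh_function R gT a f.
- move=> x y; rewrite /a eq_sym; congr (_ - _ * (_)%:R).
  by congr nat_of_bool; apply/idP/idP => /symS; rewrite invMg invgK.
- move=> x; have := aE (fun=> 1) x; under eq_bigr do rewrite mulr1.
  by move=> ->; rewrite /lap sumr_const mulVf ?subrr // lt0r_neq0.
exists u, mu; split=> //; first by move=> x; rewrite -aE eu.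
rewrite energy_lap //; under [X in _ <= _ * X]eq_bigr do rewrite -aE.
have -> : mu * (2 * #|S|%:R) * (\sum_x f x ^+ 2) = 2 * #|S|%:R * (mu * \sum_x f x ^+ 2) by ring.
by rewrite ler_pM2l // mulr_gt0.
Qed.

End Quotient.

(** * The second eigenspace *)

Section SecondEigenspace.
Local Open Scope ring_scope.
Variables (gT : finGroupType) (S : {set gT}).
Hypothesis symS : forall s, s \in S -> s^-1%g \in S.

Lemma pbP P : reflect P (pb P).
Proof. by rewrite /pb; case: excluded_middle_informative => h; constructor. Qed.

Lemma laplacianE (f : gT -> R) x : laplacian S f x = lap S f x.
Proof. by rewrite /laplacian /lap INRE. Qed.

Lemma ballE n r : (INR n <= r < INR n + 1)%Re -> Defs.ball S r = wball S n.
Proof.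
move=> nr; apply/setP => g; rewrite inE.
apply/pbP/wballP => [[w [wS [wr wg]]]|[w [wS wn wg]]]; exists w; split=> //.
  have : (INR (size w) < INR n.+1)%Re by rewrite S_INR; Lra.lra.
  by move=> /INR_lt; lia.
split=> //; have := le_INR _ _ (ssrnat.leP wn); Lra.lra.
Qed.

(** The radius [k./2 + 1/2] gives the same ball as [k./2], while its double [2 * k./2 + 1] is at
    least [k], also for odd [k]. *)
Lemma doubling_wball m : is_max_doubling S m ->
  forall k, #|wball S k|%:R <= Rmax 2 m * #|wball S k./2|%:R :> R.
Proof.
move=> [_ hm] k; have := hm (INR k./2 + / 2)%Re.
have := pos_INR k./2 => k0.
rewrite (@ballE k./2 (INR k./2 + / 2)); last by Lra.lra.
rewrite (@ballE (k./2 + k./2 + 1)); last first.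
  by rewrite !plus_INR /=; Lra.lra.
move=> /(_ ltac:(Lra.lra)) /RleP; rewrite !INRE RdivE ler_pdivrMr ?wball_card_gt0 // => h.
apply: (@le_trans _ _ (#|wball S (k./2 + k./2 + 1)|%:R : R)).
  by rewrite ler_nat subset_leq_card // wball_sub //; lia.
apply: le_trans h _; apply: ler_wpM2r => //; apply/RleP; exact: Rmax_r.
Qed.

(** The constant 1, with eigenvalue 0, and the nonconstant [u] form an independent pair. *)
Lemma count_eig_ge2 (u : gT -> R) nu x0 x1 :
  (1 < #|gT|)%N -> 0 <= nu -> 0 < #|S|%:R :> R ->
  (forall x, lap S u x = nu * u x) -> u x0 != u x1 -> (2 <= count_eig_le S nu)%N.
Proof.
move=> G1 nu0 d0 eu u01.
have G2 : (2 < #|gT|.+1)%N by [].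
apply: (leq_bigmax_cond (Ordinal G2)).
apply/pbP; exists (fun i x => if i == ord0 then 1 else u x); split.
  move=> a ha.
  pose i1 : 'I_2 := lift ord0 ord0.
  have {}ha x : a ord0 + a i1 * u x = 0.
    apply: etrans (ha x); rewrite big_ord_recl big_ord_recl big_ord0 /=.
    by transitivity (a ord0 * 1 + (a i1 * u x + 0)); first by rewrite mulr1 addr0.
  have a1 : a i1 = 0.
    apply/eqP; have : a i1 * (u x0 - u x1) = 0.
      rewrite mulrBr; apply/eqP; rewrite subr_eq0; apply/eqP.
      by apply: (addrI (a ord0)); rewrite !ha.
    by move/eqP; rewrite mulf_eq0 subr_eq0 (negbTE u01) orbF.
  have a0 : a ord0 = 0 by have := ha x0; rewrite a1 mul0r addr0.
  by move=> i; case: (unliftP ord0 i) => [j ->|->]; rewrite ?(ord1 j).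
move=> i; case: (eqVneq i ord0) => _.
  exists 0; split; first exact/RleP.
  move=> x; rewrite laplacianE /lap sumr_const mulVf ?lt0r_neq0 // subrr.
  by symmetry; exact: mul0r.
exists nu; split; first exact: Rle_refl.
by move=> x; rewrite laplacianE eu.
Qed.

Lemma eigen_ge0 (u : gT -> R) nu x :
  0 < #|S|%:R :> R -> (forall x, lap S u x = nu * u x) -> u x != 0 -> 0 <= nu.
Proof.
move=> d0 eu ux; have := energy_ge0 S u; rewrite (energy_eigen d0 eu).
have N0 := sum_sqr_gt0 ux.
by rewrite pmulr_lge0 // pmulr_rge0 // mulr_gt0.
Qed.

(** Of two independent functions one is nonconstant. Its eigenvalue is at most [mu], and cannot be
    smaller, since together with the constants it would already be counted twice. *)
Lemma lambda2_eigenvector mu : (1 < #|gT|)%N -> 0 < #|S|%:R :> R -> is_lambda2 S mu ->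
  exists f : gT -> R, exists x0 x1, (forall x, lap S f x = mu * f x) /\ f x0 != f x1.
Proof.
move=> G1 d0 [c2 cmin].
have [k [k2 [F [Fi FE]]]] : exists k : nat, (2 <= k)%N /\ exists F : 'I_k -> gT -> R,
    lin_indep F /\ forall i, exists nu, (nu <= mu)%Re /\ eigvec S nu (F i).
  have : ~~ (count_eig_le S mu <= 1)%N by rewrite -ltnNge.
  move=> /bigmax_leqP h; apply: Classical_Prop.NNPP => nex; apply: h => k /pbP hk.
  by rewrite leqNgt; apply/negP => k2; apply: nex; exists k.
have [i [x0 [x1 Fne]]] : exists i x0 x1, F i x0 != F i x1.
  apply: Classical_Prop.NNPP => nex.
  have Fc i x : F i x = F i 1%g.
    apply/eqP; apply: contraT => ne; exfalso; apply: nex; by exists i, x, 1%g.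
  case: k k2 F Fi FE nex Fc => [//|[//|k]] _ F Fi _ _ Fc.
  pose i1 : 'I_k.+2 := lift ord0 ord0.
  (* Two constants are proportional: the relation with coefficients [F i1 1%g] and [- F ord0 1%g]
     forces [F i1 1%g = 0], and then the coefficients 0 and 1 give a contradiction. *)
  have ev (a b : R) :  a * F ord0 1%g + b * F i1 1%g = 0 -> a = 0 /\ b = 0.
    move=> ab.
    have := Fi (fun i => if i == ord0 then a else if i == i1 then b else 0).
    move=> h; have {}h := h _; split.
      apply: (h _ ord0) => x.
      apply: etrans ab; rewrite big_ord_recl big_ord_recl big1 => [|j _]; last exact: mul0r.
      transitivity (a * F ord0 x + (b * F i1 x + 0)); first by [].
      by rewrite !Fc addr0.
    have {}h := h _ i1; rewrite /= in h; apply: h => x.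
    apply: etrans ab; rewrite big_ord_recl big_ord_recl big1 => [|j _]; last exact: mul0r.
    transitivity (a * F ord0 x + (b * F i1 x + 0)); first by [].
    by rewrite !Fc addr0.
  have [F1 _] : F i1 1%g = 0 /\ - F ord0 1%g = 0 by apply: ev; rewrite mulNr mulrC subrr.
  have [_ /eqP] : (0 : R) = 0 /\ (1 : R) = 0 by apply: ev; rewrite F1 mulr0 mul0r addr0.
  by rewrite oner_eq0.
have [nu [/RleP numu enu]] := FE i.
have {}enu x : lap S (F i) x = nu * F i x by rewrite -laplacianE enu.
have [y Fy] : exists y, F i y != 0.
  have [F0|] := eqVneq (F i x0) 0; last by exists x0.
  by exists x1; rewrite -F0 eq_sym.
have nu0 := eigen_ge0 d0 enu Fy.
exists (F i), x0, x1; split=> //.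
suff <- : nu = mu by [].
apply/eqP; rewrite eq_le numu leNgt; apply/negP => lt.
by have := cmin nu (RltP lt); rewrite ltnNge (count_eig_ge2 G1 nu0 d0 enu Fne).
Qed.

(** A nonzero function of mean zero is nonconstant, so [nu] is counted twice and minimality of [mu]
    applies. *)
Lemma lambda2_le (u : gT -> R) mu nu x0 :
  (1 < #|gT|)%N -> 0 < #|S|%:R :> R -> is_lambda2 S mu ->
  (forall x, lap S u x = nu * u x) -> u x0 != 0 -> \sum_x u x = 0 -> mu <= nu.
Proof.
move=> G1 d0 [_ cmin] eu ux su; rewrite leNgt; apply/negP => lt.
have nu0 := eigen_ge0 d0 eu ux.
have [x1 ux1] : exists x1, u x0 != u x1.
  apply/existsP; apply: contraNT ux => /existsPn h.
  have uc x : u x = u x0 by have := h x; rewrite negbK => /eqP.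
  move: su; under eq_bigr do rewrite uc.
  rewrite sumr_const => /eqP; rewrite mulrn_eq0 => /orP[/eqP G0|//].
  by move: G1; rewrite G0.
by have := cmin nu (RltP lt); rewrite ltnNge (count_eig_ge2 G1 nu0 d0 eu ux1).
Qed.

(** The test function bounds the eigenvalue of a mean-zero eigenfunction, which bounds [mu]; the 16
    is the 32 of the test function over the 2 of [energy_lap]. *)
Lemma lambda2_upper_bound c mu D y :
  (forall k, #|wball S k|%:R <= c * #|wball S k./2|%:R) ->
  (1 < #|gT|)%N -> 0 < #|S|%:R :> R -> is_lambda2 S mu -> y \notin wball S D ->
  mu * D.+1%:R ^+ 2 <= 16 * c.
Proof.
move=> dbl G1 d0 l2 yD.
have [f [f0 sf hf]] := small_energy_function symS dbl yD.
have [u [nu [[x0 ux] su eu hu]]] := lap_rayleigh symS d0 f0 sf.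
have munu := lambda2_le G1 d0 l2 eu ux su.
have [x fx] := f0.
have N0 := sum_sqr_gt0 fx.
have D0 : 0 <= D.+1%:R ^+ 2 :> R by exact: sqr_ge0.
apply: (@le_trans _ _ (nu * D.+1%:R ^+ 2)); first exact: ler_wpM2r.
have dN : 0 < 2 * #|S|%:R * \sum_x f x ^+ 2 by rewrite !mulr_gt0.
rewrite -(ler_pM2r dN).
have := le_trans (ler_wpM2r D0 hu) hf => h.
apply: le_trans (le_trans _ h) _; rewrite le_eqVlt; apply/orP; left; apply/eqP; ring.
Qed.

(** More eigenfunctions than net points would admit a nontrivial combination with zero sum on every
    ball; [eigen_vanish] kills it, against independence. *)
Lemma dimsub_le_net c mu D k (A : {set gT}) :
  (forall k, #|wball S k|%:R <= c * #|wball S k./2|%:R) -> 0 < #|S|%:R :> R ->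
  mu * D.+1%:R ^+ 2 <= 16 * c -> 8 * c ^+ 3 < 2 ^+ k ->
  separated S (iter k half D.+1) A ->
  (forall x, exists2 a, a \in A & (x \in a *: wball S (iter k half D.+1))%g) ->
  (dimsub (eigspace2 S mu) <= #|A|)%N.
Proof.
move=> dbl d0 hmu hk sA cA; apply/bigmax_leqP => n /pbP[F [Fi FE]].
rewrite leqNgt; apply/negP => nA.
have [v [i /negP vi] vA] := linear_dependence
  (fun i a => \sum_(x in (a *: wball S (iter k half D.+1))%g) F i x) nA.
apply: vi; apply/eqP.
pose g x : R := \sum_j v j * F j x.
suff g0 : forall x, g x = 0 by apply: (Fi v) => x; exact: g0.
have eg : forall x, lap S g x = mu * g x.
  by apply: lap_lin => i0 x; rewrite -laplacianE; exact: FE.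
apply: (eigen_vanish symS dbl d0 (ltn0Sn D) hmu hk sA cA eg) => a aA.
rewrite /g exchange_big /= -[RHS](vA a aA).
by under [RHS]eq_bigr do rewrite mulr_sumr.
Qed.

(** Elements with the same action form the classes of [class_word_length], so words of length at
    most the number of classes suffice; [1 <= n^2 c mu] then meets [mu * D.+1%:R ^+ 2 <= 16 * c]. *)
Lemma image_card_lower_bound c mu D y :
  <<S>>%g = [set: gT] ->
  (forall k, #|wball S k|%:R <= c * #|wball S k./2|%:R) ->
  (1 < #|gT|)%N -> 0 < #|S|%:R :> R -> is_lambda2 S mu -> y \notin wball S D ->
  (D.+1%:R : R) <= 4 * c * (image_card (eigspace2 S mu))%:R.
Proof.
move=> genS dbl G1 d0 l2 yD.
set W := eigspace2 S mu; set n := image_card W.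
have hmu := lambda2_upper_bound dbl G1 d0 l2 yD.
have [f [x0 [x1 [ef f01]]]] := lambda2_eigenvector G1 d0 l2.
pose cl' g := [set h | same_action W g h].
have clP g h : cl' g = cl' h <-> forall f', W f' -> forall x, f' (g^-1 * x)%g = f' (h^-1 * x)%g.
  split=> [e|e].
    have : h \in cl' g by rewrite e inE; apply/pbP.
    by rewrite inE => /pbP.
  apply/setP => k; rewrite !inE; apply/pbP/pbP => e' f' Wf x.
    by rewrite -e // e'.
  by rewrite e // e'.
(* Left translation commutes with the Laplacian, which is built from right multiplication. *)
have Wl f' a : W f' -> W (fun x => f' (a * x)%g).
  move=> Wf x; have := Wf (a * x)%g; rewrite !laplacianE /lap => <-.
  by congr (_ - _ * _); apply: eq_bigr => s _; rewrite mulgA.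
(* The action involves inverses, whereas [class_word_length] asks for compatibility with right
   multiplication; passing to [g^-1] provides it and leaves the set of classes unchanged. *)
have nE : n = #|[set cl' g^-1%g | g : gT]|.
  rewrite /n /image_card; congr #|pred_of_set _|; apply/setP => X.
  by apply/imsetP/imsetP => -[g _ ->]; exists g^-1%g; rewrite ?invgK.
have cr g : exists2 h, h \in wball S n & forall x, f (x * g)%g = f (x * h)%g.
  have [|h hn hg] := @class_word_length gT S _ (fun g => cl' g^-1%g) g genS.
    move=> a b z /clP ab; apply/clP => f' Wf x.
    by rewrite !invgK -!mulgA; have := ab f' Wf (z * x)%g; rewrite !invgK.
  exists h; first by rewrite nE.
  move=> x; have Wf : W f by move=> z; rewrite laplacianE ef.
  have /clP/(_ _ (Wl _ x Wf) 1%g) := hg.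
  by rewrite !invgK !mulg1.
have [mu0 h1] := eigen_lower_bound dbl d0 ef f01 cr.
have c1 := doubling_ge1 dbl.
have c0 : 0 <= c by rewrite (le_trans ler01).
rewrite -ler_sqr ?nnegrE ?mulr_ge0 //.
apply: (@le_trans _ _ (n%:R ^+ 2 * c * (mu * D.+1%:R ^+ 2))).
  by rewrite mulrA ler_peMl ?sqr_ge0.
have -> : (4 * c * n%:R) ^+ 2 = n%:R ^+ 2 * c * (16 * c) by ring.
by apply: ler_wpM2l hmu; rewrite mulr_ge0 // sqr_ge0.
Qed.

End SecondEigenspace.

(** * Numerical estimates and conclusion *)

Local Open Scope R_scope.

Lemma pow_between (y : R) : 1 <= y -> exists k : nat, y < 2 ^ k <= 2 * y.
Proof.
move=> y1.
have ex : exists k : nat, pb (y < 2 ^ k).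
  have [k hk] := Pow_x_infinity 2 ltac:(rewrite Rabs_right; Lra.lra) (y + 1).
  exists k; apply/pbP; have := hk k (le_n k).
  have := pow_lt 2 k ltac:(Lra.lra) => h.
  by rewrite Rabs_right; Lra.lra.
case: (ex_minnP ex) => -[|k] /pbP hk kmin; first by exists 0%nat; simpl in *; Lra.lra.
exists k.+1; split=> //.
have [h|h] := Rlt_le_dec y (2 ^ k); last by simpl; Lra.lra.
by have := kmin k (introT (pbP _) h); rewrite ltnn.
Qed.

Lemma ln_le x y : 0 < x -> x <= y -> ln x <= ln y.
Proof. by move=> x0 [/(ln_increasing _ _ x0)/Rlt_le //|->]; exact: Rle_refl. Qed.

Lemma exp_le x y : x <= y -> exp x <= exp y.
Proof. by move=> [/exp_increasing/Rlt_le //|->]; exact: Rle_refl. Qed.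

(** Logarithms give [k * ln 2 <= 7 * ln c], so [k <= 14 * ln c] by [1/2 < ln 2]; the extra factor
    [c] costs [ln c <= 2 * ln c ^ 2], for a total of 16. *)
Lemma pow_le_exp (c : R) k : 2 <= c -> 2 ^ k <= 16 * c ^ 3 -> c ^ k.+1 <= exp (16 * ln c ^ 2).
Proof.
move=> c2 hk.
have l2 := ln_lt_2.
have lc : ln 2 <= ln c by apply: ln_le; Lra.lra.
have c3 : 0 < c ^ 3 by apply: pow_lt; Lra.lra.
have : ln (2 ^ k) <= ln (2 ^ 4 * c ^ 3).
  by apply: ln_le; [apply: pow_lt; Lra.lra | simpl in *; Lra.lra].
rewrite ln_mult ?ln_pow; try (try apply: pow_lt; Lra.lra).
rewrite /INR -/(INR k) => kl.
have k14 : INR k <= 14 * ln c by have := pos_INR k; Lra.nra.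
rewrite -Rpower_pow; last by Lra.lra.
rewrite /Rpower S_INR; apply: exp_le; Lra.nra.
Qed.

(** Since [c] is 2 to the power [ln c / ln 2], taking this root of [c ^ k] leaves [2 ^ k]. *)
Lemma Rpower_log_le (c N : R) k :
  2 <= c -> 0 < N <= c ^ k -> Rpower N (/ (ln c / ln 2)) <= 2 ^ k.
Proof.
move=> c2 Nk; have l2 := ln_lt_2.
have lc : ln 2 <= ln c by apply: ln_le; Lra.lra.
have p0 : 0 < ln c / ln 2 by apply: Rdiv_lt_0_compat; Lra.lra.
apply: Rle_trans (Rle_Rpower_l _ _ _ _ Nk) _.
  by apply: Rlt_le; apply: Rinv_0_lt_compat.
rewrite -(Rpower_pow k 2); last by Lra.lra.
rewrite /Rpower ln_pow; last by Lra.lra.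
apply: Req_le; congr exp.
rewrite Rinv_div /Rdiv (Rmult_comm (INR k)) Rmult_assoc -(Rmult_assoc (/ ln c)) Rinv_l; last by Lra.lra.
by rewrite Rmult_1_l Rmult_comm.
Qed.

Theorem theorem4p1 :
  exists C : R, (1 <= C)%Re /\
  forall (gT : finGroupType) (S : {set gT}),
    (forall s, s \in S -> (s^-1)%g \in S) ->
    <<S>>%g = [set: gT] ->
    (1 < #|gT|)%N ->
    forall (m : R), is_max_doubling S m ->
    forall (lam2 : R), is_lambda2 S lam2 ->
    let cG := Rmax 2 m in
    let W := eigspace2 S lam2 in
    (INR (dimsub W) <= exp (C * (ln cG) ^ 2))%Re /\
    (Rpower (INR #|gT|) (/ (ln cG / ln 2)) / (C * Rpower cG C)
       <= INR (image_card W))%Re.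
Proof.
(* The dimension bound needs 16 by [pow_le_exp]. The image bound has room:
   [2 ^ k <= 2 * D.+1 <= 8 * c * n], and [c <= Rpower c 16]. *)
exists 16; split; first by Lra.lra.
move=> gT S symS genS G1 m hm lam2 l2 c W.
have c2 : 2 <= c by exact: Rmax_l.
have dbl := doubling_wball hm; rewrite -/c in dbl.
have d0 := gens_gt0 Rstruct.RbaseSymbolsImpl_R__canonical__Num_RealField genS G1.
have [D [y [DT yD]]] := word_diameter genS G1.
split.
  have [|k [k1 k2]] := @pow_between (8 * c ^ 3).
    by have := pow_R1_Rle c 3; Lra.lra.
  have [A sA cA] := separated_cover symS (iter k half D.+1).
  have hk : (8 * c ^+ 3 < 2 ^+ k :> R)%R.
    apply/RltP; rewrite -!RpowE -!INRE.
    by have -> : INR 8 = 8 by simpl; Lra.lra.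
  have hmu := lambda2_upper_bound symS dbl G1 d0 l2 yD.
  have dimA := dimsub_le_net symS dbl d0 hmu hk sA cA.
  have /RleP := separated_net_card symS dbl DT sA.
  rewrite -INRE -RpowE => hA.
  apply: Rle_trans (le_INR _ _ (ssrnat.leP dimA)) _.
  apply: Rle_trans hA _; apply: pow_le_exp => //; Lra.lra.
have D1 : 1 <= INR D.+1 by apply: (le_INR 1); apply/ssrnat.leP.
have [k [k1 k2]] := pow_between D1.
have Gk : INR #|gT| <= c ^ k.
  have /RleP := doubling_iter dbl k D.+1.
  rewrite DT cardsT.
  (* As [2 ^ k] exceeds [D.+1], halving [k] times reaches radius 0, a single point. *)
  have -> : iter k half D.+1 = 0%N.
    have := iter_half_le k D.+1; case: (iter k half D.+1) => // i h.
    have : INR (2 ^ k) <= INR D.+1 by apply: le_INR; apply/ssrnat.leP; lia.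
    by rewrite INRE GRing.natrX -RpowE -(INRE 2) (_ : INR 2 = 2) //; Lra.lra.
  have -> : #|wball S 0| = 1%N by rewrite /wball expg0 cards1.
  by rewrite GRing.mulr1 -INRE -RpowE.
have G0 : 0 < INR #|gT| by apply: lt_0_INR; apply/ssrnat.ltP; exact: ltnW.
have h1 := Rpower_log_le c2 (conj G0 Gk).
have /RleP := image_card_lower_bound symS genS dbl G1 d0 l2 yD.
rewrite -/W -!INRE -!RmultE => h2.
have n0 : 0 <= INR (image_card W) by exact: pos_INR.
have h3 : c <= Rpower c 16 by rewrite -{1}(Rpower_1 c); [apply: Rle_Rpower|]; Lra.lra.
have c16 : 0 < 16 * Rpower c 16 by Lra.lra.
apply: (Rmult_le_reg_r _ _ _ c16).
rewrite /Rdiv Rmult_assoc Rinv_l -/(Rdiv (ln c) (ln 2)); last by Lra.lra.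
have h4 : c * INR (image_card W) <= Rpower c 16 * INR (image_card W) by apply: Rmult_le_compat_r.
have e4 : INR 4 = 4 by simpl; Lra.lra.
rewrite e4 in h2; Lra.lra.
Qed.
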